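(* Let $\mathcal{M}_1=(X,rk,m_1)$ and $\mathcal{M}_2=(X,rk,m_2)$ be two arithmetic matroids over the same underlying matroid $(X,rk)$, and let $\mathcal{M}=\mathcal{M}_1\bullet\mathcal{M}_2=(X,rk,m_1m_2)$ be their product. Then $$\mathcal{Z}_{\mathcal{M}}(pq,\mathbf{uv})=\sum_{T\subseteq X}p^{-rk(T)}\Big(\prod_{e\in T}(-u_e)\Big)\,\mathcal{Z}_{\mathcal{M}_1|T}(q,-\mathbf{v})\,\mathcal{Z}_{\mathcal{M}_2/T}(p,\mathbf{u})$$ and $$\mathcal{Z}_{\mathcal{M}}(pq,\mathbf{uv})=\sum_{T\subseteq X}p^{-rk(T)}\Big(\prod_{e\in T}(-u_e)\Big)\,\mathcal{Z}_{\mathcal{M}_2|T}(q,-\mathbf{v})\,\mathcal{Z}_{\mathcal{M}_1/T}(p,\mathbf{u}).$$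
   Context: A matroid $(X,rk)$ is given by a finite ground set $X$ and its rank function $rk$. A multiplicity matroid is a triple $\mathcal{M}=(X,rk,m)$ where $(X,rk)$ is a matroid and $m:2^X\to\mathbb{Z}_{>0}$ is any function. It is an arithmetic matroid if $m$ satisfies: (1) for all $A\subseteq X$ and $e\in X$: if $rk(A\cup\{e\})=rk(A)$ then $m(A\cup\{e\})$ divides $m(A)$; otherwise $m(A)$ divides $m(A\cup\{e\})$; (2) if $A\subseteq B\subseteq X$ and $B$ is a disjoint union $B=A\cup F\cup T$ such that $rk(C)=rk(A)+|C\cap F|$ for all $A\subseteq C\subseteq B$, then $m(A)m(B)=m(A\cup F)m(A\cup T)$; (3) if $A\subseteq B\subseteq X$ and $rk(A)=rk(B)$, then $\sum_{A\subseteq T\subseteq B}(-1)^{|T|-|A|}m(T)\ge 0$; (4) if $A\subseteq B\subseteq X$ and $rk^*(A)=rk^*(B)$, then $\sum_{A\subseteq T\subseteq B}(-1)^{|T|-|A|}m(X\setminus T)\ge 0$, where $rk^*(A)=|A|+rk(X\setminus A)-rk(X)$. Product: $\mathcal{M}_1\bullet\mathcal{M}_2=(X,rk,m_1m_2)$, where $(m_1m_2)(A)=m_1(A)m_2(A)$ for $A\subseteq X$. For $T\subseteq X$, the restriction $\mathcal{M}|T$ is the multiplicity matroid on $T$ obtained by restricting $rk$ and $m$ to subsets of $T$. The contraction $\mathcal{M}/T$ is the multiplicity matroid on $X\setminus T$ with $rk_{\mathcal{M}/T}(A)=rk(A\cup T)-rk(T)$ and $m_{\mathcal{M}/T}(A)=m(A\cup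 T)$ for $A\subseteq X\setminus T$. Let $p,q$ and $u_e,v_e$ ($e\in X$) be commuting variables. The multivariate arithmetic Tutte polynomial is $$\mathcal{Z}_{\mathcal{M}}(q,\mathbf{v})=\sum_{A\subseteq X}m(A)\,q^{-rk(A)}\prod_{e\in A}v_e .$$ Here $\mathbf{v}=\{v_e:e\in X\}$, $\mathbf{u}=\{u_e:e\in X\}$, $\mathbf{uv}=\{u_ev_e:e\in X\}$, $-\mathbf{v}=\{-v_e:e\in X\}$. For a restriction or contraction, the same formula is used with that multiplicity matroid's own ground set, rank function and multiplicity, and only the variables indexed by elements of its ground set are used. *)

(* Defs.v *)
From mathcomp Require Import all_boot all_order all_algebra.
From mathcomp Require Import zify.
Set Implicit Arguments.
Unset Strict Implicit.
Unset Printing Implicit Defensive.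
Import Order.TTheory GRing.Theory Num.Theory.
Local Open Scope ring_scope.

(* The ground set is a subset of an ambient finite type E, so that restrictions
   and contractions live over the same E.  Only the values of rk and mult on
   subsets of the ground set are meaningful; all axioms and sums below are
   relative to such subsets. *)
Record mult_matroid (E : finType) := MultMatroid {
  ground : {set E};
  rk : {set E} -> nat;
  mult : {set E} -> nat
}.

Definition is_matroid (E : finType) (X : {set E}) (r : {set E} -> nat) : Prop :=
  [/\ forall A : {set E}, A \subset X -> (r A <= #|A|)%N,
      forall A B : {set E}, A \subset B -> B \subset X -> (r A <= r B)%N
    & forall A B : {set E}, A \subset X -> B \subset X ->
        (r (A :|: B) + r (A :&: B) <= r A + r B)%N].

Definition is_mult_matroid (E : finType) (M : mult_matroid E) : Prop :=
  is_matroid (ground M) (rk M) /\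
  (forall A : {set E}, A \subset ground M -> (0 < mult M A)%N).

(* The truncated subtraction is exact on subsets A of the ground set of a
   matroid, by submodularity. *)
Definition dual_rk (E : finType) (M : mult_matroid E) (A : {set E}) : nat :=
  (#|A| + rk M (ground M :\: A) - rk M (ground M))%N.

Definition arith_divisibility (E : finType) (M : mult_matroid E) : Prop :=
  forall (A : {set E}) (e : E), A \subset ground M -> e \in ground M ->
    if rk M (e |: A) == rk M A
    then (mult M (e |: A) %| mult M A)%N
    else (mult M A %| mult M (e |: A))%N.

Definition arith_molecule (E : finType) (M : mult_matroid E) : Prop :=
  forall A B F T : {set E}, A \subset B -> B \subset ground M ->
    B = A :|: F :|: T ->
    [disjoint A & F] -> [disjoint A & T] -> [disjoint F & T] ->
    (forall C : {set E}, A \subset C -> C \subset B ->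
       rk M C = (rk M A + #|C :&: F|)%N) ->
    (mult M A * mult M B = mult M (A :|: F) * mult M (A :|: T))%N.

Definition arith_positivity (E : finType) (M : mult_matroid E) : Prop :=
  forall A B : {set E}, A \subset B -> B \subset ground M ->
    rk M A = rk M B ->
    0 <= \sum_(T : {set E} | (A \subset T) && (T \subset B))
           (-1) ^+ (#|T| - #|A|) * (mult M T)%:Z.

Definition arith_dual_positivity (E : finType) (M : mult_matroid E) : Prop :=
  forall A B : {set E}, A \subset B -> B \subset ground M ->
    dual_rk M A = dual_rk M B ->
    0 <= \sum_(T : {set E} | (A \subset T) && (T \subset B))
           (-1) ^+ (#|T| - #|A|) * (mult M (ground M :\: T))%:Z.

Definition is_arithmetic_matroid (E : finType) (M : mult_matroid E) : Prop :=
  [/\ is_mult_matroid M, arith_divisibility M, arith_molecule M,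
      arith_positivity M & arith_dual_positivity M].

(* Intended for M1 and M2 with the same ground set and rank function. *)
Definition mm_product (E : finType) (M1 M2 : mult_matroid E) : mult_matroid E :=
  MultMatroid (ground M1) (rk M1) (fun A => (mult M1 A * mult M2 A)%N).

Definition mm_restrict (E : finType) (M : mult_matroid E) (T : {set E}) :
    mult_matroid E :=
  MultMatroid T (rk M) (mult M).

Definition mm_contract (E : finType) (M : mult_matroid E) (T : {set E}) :
    mult_matroid E :=
  MultMatroid (ground M :\: T) (fun A => (rk M (A :|: T) - rk M T)%N)
              (fun A => mult M (A :|: T)).

(* The variables are arbitrary elements of a commutative ring R; since q occurs
   with negative exponents, this is meant for q a unit of R. *)
Definition arith_tutte (E : finType) (R : comUnitRingType)
    (M : mult_matroid E) (q : R) (v : E -> R) : R :=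
  \sum_(A : {set E} | A \subset ground M)
    (mult M A)%:R * q ^- rk M A * \prod_(e in A) v e.

Lemma mm_restrict_mult_matroid (E : finType) (M : mult_matroid E)
    (T : {set E}) :
  is_mult_matroid M -> T \subset ground M -> is_mult_matroid (mm_restrict M T).
Proof.
move=> [[rk_card rk_mono rk_sub] mult_gt0] sTX.
have sub (A : {set E}) : A \subset T -> A \subset ground M by move/subset_trans; apply.
split=> [|A /sub]; last exact: mult_gt0.
split=> /= [A /sub|A B sAB /sub|A B /sub sA /sub]; first exact: rk_card.
  exact: rk_mono.
exact: rk_sub.
Qed.

Lemma mm_contract_mult_matroid (E : finType) (M : mult_matroid E)
    (T : {set E}) :
  is_mult_matroid M -> T \subset ground M -> is_mult_matroid (mm_contract M T).
Proof.
move=> [[rk_card rk_mono rk_sub] mult_gt0] sTX.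
have sub (A : {set E}) : A \subset ground M :\: T -> A \subset ground M.
  by move/subset_trans; apply; exact: subsetDl.
have subU (A : {set E}) : A \subset ground M :\: T -> A :|: T \subset ground M.
  by move/sub=> sA; rewrite subUset sA.
have rkT (A : {set E}) : A \subset ground M :\: T -> (rk M T <= rk M (A :|: T))%N.
  by move/subU; apply: rk_mono; exact: subsetUr.
split=> [|A /subU]; last exact: mult_gt0.
split=> /= [A sA|A B sAB sB|A B sA sB].
- rewrite leq_subLR addnC; apply: leq_trans (leq_addr (rk M (A :&: T)) _) _.
  by apply: leq_trans (rk_sub _ _ (sub _ sA) sTX) _; rewrite leq_add2r rk_card ?sub.
- by apply: leq_sub2r; apply: rk_mono; [exact: setSU | exact: subU].
- have := rk_sub _ _ (subU _ sA) (subU _ sB); rewrite -setUUl -setUIl.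
  have sI : A :&: B \subset ground M :\: T.
    by apply: subset_trans sA; exact: subsetIl.
  have sU : A :|: B \subset ground M :\: T by rewrite subUset sA.
  have := rkT _ sA; have := rkT _ sB; have := rkT _ sI; have := rkT _ sU; lia.
Qed.

(* Main.v *)
Require Import Defs.
From mathcomp Require Import all_boot all_order all_algebra.
From mathcomp Require Import ring.
Import GRing.Theory.
Local Open Scope ring_scope.

(** Expand both polynomials on the right-hand side.  A summand of the restriction
    to T is indexed by a set A inside T, and a summand of the contraction by T
    becomes, after adding T to its index, a summand indexed by a set C with
    T inside C inside X: the prefactor p^(-rk T) turns the rank of the contraction
    back into the rank of C, and the prefactor prod_(e in T) (- u_e) completes the
    monomial of C up to the sign (-1)^|T| ([arith_tutte_contract]).  The
    coefficient of the pair (A, C) is then, up to factors that do not involve T,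
    the alternating sum of (-1)^|T| over the interval A <= T <= C of the Boolean
    lattice, which vanishes unless A = C ([alternating_sum_interval], Moebius
    inversion).  The surviving diagonal terms m1(A) m2(A) (pq)^(-rk A)
    prod_(e in A) u_e v_e add up to the polynomial of the product.  The roles of
    the two multiplicities can be exchanged because the left-hand side is
    symmetric in them. *)

(** The summand is the T-term in the expansion of a product over all elements:
    elements of A contribute (-1) + 0, those of C \ A contribute (-1) + 1, and
    those outside C contribute 0 + 1.  Hence one element of C \ A makes the
    whole sum vanish. *)
Lemma alternating_sum_interval (E : finType) (R : comPzRingType) (A C : {set E}) :
  A \subset C ->
  \sum_(T : {set E} | (A \subset T) && (T \subset C)) (-1) ^+ #|T|
    = (if A == C then (-1) ^+ #|A| else 0) :> R.
Proof.
move=> sAC.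
pose F e : R := if e \in C then -1 else 0.
pose G e : R := if e \in A then 0 else 1.
have expand : \prod_e (F e + G e) =
    \sum_(T : {set E} | (A \subset T) && (T \subset C)) (-1) ^+ #|T|.
  rewrite bigA_distr [RHS]big_mkcond; apply: eq_bigr => T _.
  case: ifPn => [/andP[sAT sTC]|].
    rewrite -prodr_const [RHS]big_mkcond; apply: eq_bigr => e _.
    rewrite /F /G; case: ifPn => [/(subsetP sTC)->|] //.
    by move/(contra (subsetP sAT e))/negPf->.
  rewrite negb_and => /orP[] /subsetPn[e e1 e2]; rewrite (bigD1 e) //=.
    by rewrite (negPf e2) /G e1 mul0r.
  by rewrite e1 /F (negPf e2) mul0r.
rewrite -expand; case: eqP => [eqAC|/eqP neAC].
  rewrite -prodr_const [RHS]big_mkcond; apply: eq_bigr => e _.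
  by rewrite /F /G -eqAC; case: ifP; rewrite ?addr0 ?add0r.
have /subsetPn[e eC eA] : ~~ (C \subset A).
  by apply: contra neAC => sCA; rewrite eqEsubset sAC.
by rewrite (bigD1 e) //= /F /G eC (negPf eA) addNr mul0r.
Qed.

(** Reindexing along the bijection B |-> B :|: T from the subsets of the contracted
    ground set to the sets between T and the whole ground set.  Monotonicity of
    the rank makes the subtraction in the contracted rank exact, so that the
    powers of p multiply to p^(-rk (B :|: T)). *)
Lemma arith_tutte_contract (E : finType) (R : comUnitRingType)
    (M : mult_matroid E) (T : {set E}) (p : R) (u : E -> R) :
  is_matroid (ground M) (rk M) -> T \subset ground M ->
  p ^- rk M T * (\prod_(e in T) (- u e)) * arith_tutte (mm_contract M T) p u =
  (-1) ^+ #|T| *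
    \sum_(C : {set E} | (T \subset C) && (C \subset ground M))
      (mult M C)%:R * p ^- rk M C * \prod_(e in C) u e.
Proof.
case=> _ rk_mono _ sTX; rewrite prodrN /arith_tutte !mulr_sumr /=.
have setDTK (C : {set E}) : T \subset C -> C :\: T :|: T = C.
  by move=> /setIidPr sTC; rewrite setUC -{1}sTC setID.
rewrite [RHS](reindex_onto (fun B => B :|: T) (fun C => C :\: T)) /=; last first.
  by move=> C /andP[/setDTK].
apply: eq_big => [B|B].
  rewrite subsetUr subUset sTX andbT subsetD; congr (_ && _).
  by rewrite setDUl setDv setU0 (sameP setDidPl eqP).
rewrite subsetD => /andP[sBX dBT].
have rkTB : (rk M T <= rk M (B :|: T))%N.
  by apply: rk_mono; rewrite ?subsetUr // subUset sBX.
rewrite -!exprVn -[in RHS](subnKC rkTB) exprD.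
have -> : \prod_(e in B :|: T) u e = (\prod_(e in B) u e) * \prod_(e in T) u e.
  by rewrite -bigU //; apply: eq_bigl => e; rewrite !inE.
by ring.
Qed.

(** Exchanging the sums puts the one over T innermost, where it is the
    alternating sum over an interval; the sign (-1)^|A| in [f], coming from - v,
    then cancels the sign that this sum leaves at A = C. *)
Lemma arith_tutte_product (E : finType) (X : {set E}) (r m1 m2 : {set E} -> nat)
    (R : comUnitRingType) (p q : R) (u v : E -> R) :
  p \is a GRing.unit -> q \is a GRing.unit -> is_matroid X r ->
  arith_tutte (mm_product (MultMatroid X r m1) (MultMatroid X r m2)) (p * q)
      (fun e => u e * v e) =
    \sum_(T : {set E} | T \subset X)
      p ^- r T * (\prod_(e in T) (- u e)) *
      arith_tutte (mm_restrict (MultMatroid X r m1) T) q (fun e => - v e) *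
      arith_tutte (mm_contract (MultMatroid X r m2) T) p u.
Proof.
move=> p_unit q_unit matX.
pose f A := (m1 A)%:R * q ^- r A * (-1) ^+ #|A| * \prod_(e in A) v e.
pose g C := (m2 C)%:R * p ^- r C * \prod_(e in C) u e.
have expand (T : {set E}) : T \subset X ->
    p ^- r T * (\prod_(e in T) (- u e)) *
      arith_tutte (mm_restrict (MultMatroid X r m1) T) q (fun e => - v e) *
      arith_tutte (mm_contract (MultMatroid X r m2) T) p u =
    \sum_(C : {set E} | (T \subset C) && (C \subset X))
      \sum_(A : {set E} | A \subset T) f A * g C * (-1) ^+ #|T|.
  move=> sTX; rewrite mulrAC (arith_tutte_contract _ _ (MultMatroid X r m2)) //.
  rewrite mulrAC mulr_sumr.
  apply: eq_bigr => C _; rewrite /arith_tutte !mulr_sumr mulr_suml.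
  by apply: eq_bigr => A _; rewrite prodrN /f /g /=; ring.
rewrite (eq_bigr _ expand) (exchange_big_dep (fun C : {set E} => C \subset X)) /=;
  last first.
  by move=> T C _ /andP[].
apply: eq_bigr => C sCX.
rewrite (exchange_big_dep (fun A : {set E} => A \subset C)) /=; last first.
  by move=> T A /and3P[_ sTC _] /subset_trans->.
transitivity (\sum_(A : {set E} | A \subset C)
    f A * g C * (if A == C then (-1) ^+ #|A| else 0)); last first.
  apply: eq_bigr => A sAC; rewrite -(alternating_sum_interval E R A C sAC) mulr_sumr.
  apply: eq_bigl => T; rewrite sCX andbT [RHS]andbC; congr (_ && _).
  by rewrite andb_idl // => sTC; apply: subset_trans sCX.
rewrite (bigD1 C) //= eqxx [X in _ + X]big1 ?addr0; last first.
  by move=> A /andP[_ /negPf->]; rewrite mulr0.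
rewrite natrM exprMn invrM ?unitrX // big_split /= /f /g.
have sgnK : (-1) ^+ #|C| * (-1) ^+ #|C| = 1 :> R by rewrite -expr2 sqrr_sign.
by rewrite -[LHS]mulr1 -[X in _ * X = _]sgnK; ring.
Qed.

Theorem theorem2p1 (E : finType) (X : {set E}) (r m1 m2 : {set E} -> nat)
    (R : comUnitRingType) (p q : R) (u v : E -> R)
    (hp : p \is a GRing.unit) (hq : q \is a GRing.unit) :
  let M1 := MultMatroid X r m1 in
  let M2 := MultMatroid X r m2 in
  let M := mm_product M1 M2 in
  is_arithmetic_matroid M1 -> is_arithmetic_matroid M2 ->
  arith_tutte M (p * q) (fun e => u e * v e) =
    \sum_(T : {set E} | T \subset X)
      p ^- r T * (\prod_(e in T) (- u e)) *
      arith_tutte (mm_restrict M1 T) q (fun e => - v e) *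
      arith_tutte (mm_contract M2 T) p u
  /\
  arith_tutte M (p * q) (fun e => u e * v e) =
    \sum_(T : {set E} | T \subset X)
      p ^- r T * (\prod_(e in T) (- u e)) *
      arith_tutte (mm_restrict M2 T) q (fun e => - v e) *
      arith_tutte (mm_contract M1 T) p u.
Proof.
move=> M1 M2 M [[matX _] _ _ _ _] _; split; first exact: arith_tutte_product.
rewrite -arith_tutte_product //.
by apply: eq_bigr => A _ /=; rewrite mulnC.
Qed.
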